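(* Let the maximum side-ramp recursion index of the ReRamp algorithm be $i_r\ge1$. The worst-case ReRamp algorithm maximum construction height is $\Omega(\sqrt{|a|})$, where $|a|$ is the size (vertex count) of the ramp area $a$; that is, there are positive constants $C,n_0$ such that for every ramp area $a$ with $|a|\ge n_0$ the worst-case maximum construction height of the ReRamp algorithm in $a$ is at least $C\sqrt{|a|}$.
   Context: **Setting.** Let $\widehat{i}=\{0,\dots,i-1\}$. Grid positions $\mathcal{P}=\widehat X\times\widehat Y$, neighbors $\mathcal{N}_{(x,y)}=\{(x\pm1,y),(x,y\pm1)\}\cap\mathcal{P}$; $z_{t,x,y}$ is the number of blocks at $(x,y)$ at timestep $t$. Border positions have $x\in\{0,X-1\}$ or $y\in\{0,Y-1\}$ and never contain blocks; $\mathcal{P}_\boxdot$ is the set of non-border positions. Agents stand on top of columns, carry at most one block, and can: enter/leave at a border position; move to a neighbor if heights differ by at most $1$; deliver the carried block to a neighbor of equal height (before the action); pick up the top block of a neighbor whose height equals the agent's height after the action; wait. A ramp area is a connected component, having a position neighboring some border position, of the grid graph induced on non-border positions of current height $0$. **Compound ramps.** A (compound) ramp is a tuple $(p,\mathcal{S},f)$, with central path $p=v_0,\dots,v_k$ ($v_0\in\mathcal{P}$ the connection point $c_\odot p$; $v_1,\dots,v_k\in\mathcal{P}_\boxdot$; last node $l_p$), a sequence $\mathcal{S}$ of reversible ramps (side ramps) attached by their connection points to nodes of $p$, and floor height $f$. The relative reversible height $\mathrm{rrh}_t(s)$ of a reversible ramp $s$ at time $t$ is its height relative to its floor in its backward state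 when all its backward side ramps are also reversed. The ramp is valid if all its side ramps are reversible and at all times each $(x,y)\in p$ with successor $(x',y')$ satisfies $0\le z_{t,x',y'}-z_{t,x,y}\le1+\sum_{s\in\mathcal{S}:c_\odot s=(x,y)}\mathrm{rrh}_t(s)$. A ramp is reversible if it is valid and there is a pair (forward ramp, backward ramp) of ramps with the same floor height and a sequence of actions moving all blocks from the forward ramp (initially holding all blocks) to the backward ramp (initially empty). To move up the central path, an agent reverses one by one (in the order of $\mathcal{S}$) the side ramps attached to its current node to the backward state, stands on the highest block of the last one and steps to the next node; moving down is the reverse process. The maximum reversible height $\mathrm{rrh}(s)$ of a ramp $s$ is obtained by extending the backward ramp from one end of the central path of $s$ and the forward ramp from the other end, keeping the backward ramp's capacity at most that of the forward ramp, until the two connection points meet at a pivot node; side ramps at the pivot are assigned to the backward or forward ramp so as to maximize backward height under the capacity constraint; the procedure is repeated with the backward ramp having no side ramps (the forward one still having them), and the backward ramp of larger height is chosen; $\mathrm{rrh}(s)$ is its height. A ramp is full when all side ramps are at reversible capacity (the capacity of their backward ramp), successive central-path heights differ by $1+\sum_{s:c_\odot s=v_i}\mathrm{rrh}(s)$, and side ramps at $l_p$, when reversed, together reach $\sum_{s:c_\odot s=l_p}\mathrm{rrh}(s)$ above the floor of the first one; its capacity is its number of blocks above the floor when full. **RFT (ramp from tree).** Input: rooted tree, node $v_k$, index $i_r$. Starting from $v_i=v_k$, while $v_i$ is not the root: add $v_i$ to the central path; if $i_r>0$, for each child $v_c$ of $v_i$ not in the central path, let $n_d$ be the node farthest from $v_c$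 not crossing $v_i$, form the side ramp RFT(the tree rooted at $v_i$, $n_d$, $i_r-1$), and add it to $\mathcal{S}$ if its reversible height is positive; then replace $v_i$ by its parent. Finally add the root to the central path and return $(p,\mathcal{S},0)$. **ReRamp in a ramp area.** To deconstruct (equivalently, by reversing the plan, construct) a structure column next to a position $v_k$ of a ramp area $a$, ReRamp takes a spanning tree of $a$ found by depth-first search, with a border position $v_0$ added as a leaf and taken as the root, forms the ramp $r=\mathrm{RFT}(\text{tree},v_k,i_r)$ and builds it up, at most until it is full. The construction height of ReRamp for this choice is the height of the full ramp $r$ including its reversed side ramps, i.e. $k+\sum_{s\in\mathcal{S}}\mathrm{rrh}(s)$, where $k\ge1$ is the number of edges of the central path. The worst-case maximum construction height in $a$ is the minimum of this quantity over all choices of the border position $v_0$ neighboring $a$, the depth-first-search spanning tree and the position $v_k\in a$. *)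

(* Defs.v *)
From mathcomp Require Import all_boot.

Set Implicit Arguments.
Unset Strict Implicit.
Unset Printing Implicit Defensive.

Definition pos (X Y : nat) : finType := ('I_X * 'I_Y)%type.

Definition border X Y (p : pos X Y) : bool :=
  [|| p.1 == 0 :> nat, p.1 == X.-1 :> nat, p.2 == 0 :> nat | p.2 == Y.-1 :> nat].

Definition nbr X Y (p q : pos X Y) : bool :=
  ((p.2 == q.2) && ((p.1.+1 == q.1) || (q.1.+1 == p.1))) ||
  ((p.1 == q.1) && ((p.2.+1 == q.2) || (q.2.+1 == p.2))).

(* [z p] is the height of the column [p] at the current timestep. *)
Definition world X Y (z : pos X Y -> nat) : Prop :=
  forall p, border p -> z p = 0.

Definition empty_pos X Y (z : pos X Y -> nat) (p : pos X Y) : bool :=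
  ~~ border p && (z p == 0).

Definition ramp_area X Y (z : pos X Y -> nat) (a : {set pos X Y}) : Prop :=
  (exists2 x, empty_pos z x &
     a = [set y | connect [rel p q | [&& nbr p q, empty_pos z p & empty_pos z q]] x y])
  /\ (exists p b, [/\ p \in a, border b & nbr p b]).

(* [dfs e a st D E] : some depth-first search of the graph [e] started at a
   node of [a] reaches the state where [st] is the stack, [D] the set of
   discovered nodes and [E] the list of (parent, child) tree edges.  The start
   node and the order in which neighbors are examined are unconstrained. *)
Inductive dfs (T : finType) (e : rel T) (a : {set T}) :
    seq T -> {set T} -> seq (T * T) -> Prop :=
| dfs_start r of r \in a : dfs e a [:: r] [set r] [::]
| dfs_push v u st D E of dfs e a (v :: st) D E & e v u & u \notin D :
    dfs e a [:: u, v & st] (u |: D) ((v, u) :: E)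
| dfs_pop v st D E of dfs e a (v :: st) D E & (forall u, e v u -> u \in D) :
    dfs e a st D E.

Definition dfs_spanning_tree X Y (a : {set pos X Y}) (E : seq (pos X Y * pos X Y)) : Prop :=
  exists D, dfs [rel p q | [&& nbr p q, p \in a & q \in a]] a [::] D E.

Definition tree_rel (T : eqType) (E : seq (T * T)) : rel T :=
  fun u v => ((u, v) \in E) || ((v, u) \in E).

(* [Ramp v0 [:: v1; ...; vk] ss f] is the ramp with central path v0, v1, ..., vk,
   sequence of side ramps ss and floor height f; a side ramp is attached to the
   node that is its own connection point. *)
Inductive ramp (T : Type) : Type := Ramp of T & seq T & seq (ramp T) & nat.

Definition conn T (r : ramp T) : T := let: Ramp v0 _ _ _ := r in v0.
Definition cpath T (r : ramp T) : seq T := let: Ramp v0 q _ _ := r in v0 :: q.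
Definition sides T (r : ramp T) : seq (ramp T) := let: Ramp _ _ ss _ := r in ss.
Definition floor_height T (r : ramp T) : nat := let: Ramp _ _ _ f := r in f.

Definition edges T (r : ramp T) : nat := (size (cpath r)).-1.
Definition node (T : Type) (r : ramp T) (i : nat) : T := nth (conn r) (cpath r) i.

(* Positions occupied by a ramp and its side ramps, minus the connection point. *)
Fixpoint footprint T (r : ramp T) : nat :=
  let: Ramp _ q ss _ := r in size q + sumn (map (@footprint T) ss).

Definition sides_at (T : eqType) (r : ramp T) (v : T) : seq (ramp T) :=
  [seq s <- sides r | conn s == v].

Section Reversal.
Variable T : eqType.

(* Maximum reversible height, and reversible capacity (capacity of the
   backward ramp), of every ramp; they are tied together by
   [max_reversal] below. *)
Variables rrh rcap : ramp T -> nat.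
Implicit Types (r s b : ramp T) (A : pred (ramp T)).

(* Height of a full ramp above its floor, with all its side ramps reversed. *)
Definition height r : nat := edges r + \sum_(s <- sides r) rrh s.

(* Height above the floor of the i-th central path node of a full ramp, side
   ramps not reversed. *)
Definition level r i : nat :=
  i + \sum_(j < i) \sum_(s <- sides_at r (node r j)) rrh s.

(* Blocks in side ramps attached to one node, counted from the floor of the
   carrying ramp.  The floor of the first one is [h]; the floor of each next
   one is where the agent stands once the previous one is reversed.  The
   columns below the floor of a side ramp are filled with blocks. *)
Fixpoint side_blocks (h : nat) (ss : seq (ramp T)) : nat :=
  if ss is s :: ss' then h * footprint s + rcap s + side_blocks (h + rrh s) ss'
  else 0.

Definition capacity r : nat :=
  \sum_(i < size (cpath r))
     (level r i + side_blocks (level r i) (sides_at r (node r i))).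

(* Backward and forward ramps of [r] with connection point [node r i]; among
   the side ramps attached to the connection point they keep those in [A]. *)
Definition backward A r i : ramp T :=
  Ramp (node r i) (rev (take i (cpath r)))
       [seq s <- sides r | (conn s \in take i (cpath r)) || (conn s == node r i) && A s]
       (floor_height r).

Definition plain_backward r i : ramp T :=
  Ramp (node r i) (rev (take i (cpath r))) [::] (floor_height r).

Definition forward A r i : ramp T :=
  Ramp (node r i) (drop i.+1 (cpath r))
       [seq s <- sides r | (conn s \in drop i.+1 (cpath r)) || (conn s == node r i) && A s]
       (floor_height r).

(* The backward ramp B has reached index [i] and the forward ramp F index
   [i + n]: extend B if its capacity stays at most that of F, otherwise extend
   F, until they meet. *)
Fixpoint pivot (B F : nat -> ramp T) (n i : nat) : nat :=
  if n is n'.+1 then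
    if capacity (B i.+1) <= capacity (F (i + n)) then pivot B F n' i.+1
    else pivot B F n' i
  else i.

(* Before the pivot is known, side ramps at the two connection points are not
   yet assigned to any of the two ramps. *)
Definition backward_with_sides r b : Prop :=
  let m := pivot (backward pred0 r) (forward pred0 r) (edges r) 0 in
  let feasible A := capacity (backward A r m) <= capacity (forward (predC A) r m) in
  exists A, [/\ b = backward A r m, feasible A &
    forall A', feasible A' -> height (backward A' r m) <= height b].

Definition backward_without_sides r b : Prop :=
  b = plain_backward r (pivot (plain_backward r) (forward pred0 r) (edges r) 0).

Definition chosen_backward r b : Prop :=
  exists b1 b2, [/\ backward_with_sides r b1, backward_without_sides r b2 &
    (b = b1 /\ height b2 <= height b1) \/ (b = b2 /\ height b1 <= height b2)].

(* [rrh] and [rcap] result from the procedure, for some way of breaking ties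
   between backward ramps of equal height. *)
Definition max_reversal : Prop :=
  forall r, exists b,
    [/\ chosen_backward r b, rrh r = height b & rcap r = capacity b].

End Reversal.

Definition simple_path (T : eqType) (t : rel T) (x : T) (q : seq T) : bool :=
  path t x q && uniq (x :: q).

(* [nd] is a node farthest from [vc] in the tree [t], not crossing [vi]. *)
Definition farthest (T : eqType) (t : rel T) (vi vc nd : T) : Prop :=
  exists q, [/\ simple_path t vc q, vi \notin vc :: q, last vc q = nd &
    forall q', simple_path t vc q' -> vi \notin vc :: q' -> size q' <= size q].

(* [RFT t rrh i root vk r] : [r] is a possible result for the tree [t] rooted
   at [root].  Climbing from [vk] to the root by parents follows the simple path
   [root :: q] backwards, and the children of a node of [q] off the central path
   are its neighbors off that path.  [ch] is the order in which children are
   processed and [sd vi vc] the side ramp formed for the child [vc] of [vi]. *)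
Fixpoint RFT (T : finType) (t : rel T) (rrh : ramp T -> nat) (i : nat)
    (root vk : T) (r : ramp T) : Prop :=
  exists (q : seq T) (ss : seq (ramp T)),
    [/\ simple_path t root q, last root q = vk, r = Ramp root q ss 0 &
      if i is i'.+1 then
        exists (ch : T -> seq T) (sd : T -> T -> ramp T),
          [/\ forall vi, vi \in q ->
                perm_eq (ch vi) [seq vc <- enum T | t vi vc && (vc \notin root :: q)],
              forall vi vc, vi \in q -> vc \in ch vi ->
                exists2 nd, farthest t vi vc nd & RFT t rrh i' vi nd (sd vi vc) &
              ss = [seq s <- [seq sd vi vc | vi <- rev q, vc <- ch vi] | 0 < rrh s]]
      else ss = [::]].

(* The border root [v0] is joined as a leaf to the node [w] of [a].  Choices the
   algorithm leaves open (equal heights, equal distances, orders of children) are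
   part of the worst case. *)
Definition reramp_height X Y (i_r : nat) (a : {set pos X Y}) (h : nat) : Prop :=
  exists (rrh rcap : ramp (pos X Y) -> nat) (v0 w vk : pos X Y)
         (E : seq (pos X Y * pos X Y)) (r : ramp (pos X Y)),
    [/\ max_reversal rrh rcap,
        [/\ border v0, w \in a & nbr v0 w],
        dfs_spanning_tree a E /\ vk \in a,
        RFT (tree_rel ((v0, w) :: E)) rrh i_r v0 vk r &
        h = height rrh r].

Definition worst_case_reramp_height X Y (i_r : nat) (a : {set pos X Y}) (h : nat) : Prop :=
  reramp_height i_r a h /\ forall h', reramp_height i_r a h' -> h <= h'.

(* Main.v *)
(* A connected set of n grid nodes contains, for every node v_k of it, a node u
   whose distance to v_k is of order sqrt n, since a ball of radius d has at most
   (2d+1)^2 nodes.  In the spanning tree the path from v_k to u first follows the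
   central path (at most k edges) and then enters one branch, whose depth is
   bounded by the length L of the side ramp formed for that branch.  Even without
   side ramps of its own, a side ramp of length L can be reversed to height at
   least (L-1)/2, because the backward ramp is extended as long as it is not longer
   than the forward ramp.  Hence the height h of the full ramp satisfies
   k + L <= 2h + 1, and n <= (4h+3)^2 <= (7h)^2. *)

Require Import Defs.
From mathcomp Require Import all_boot all_order all_algebra.
From mathcomp Require Import reals zify.
Import Order.TTheory GRing.Theory Num.Theory.

Set Implicit Arguments.
Unset Strict Implicit.
Unset Printing Implicit Defensive.

(** * Reversing a single ramp to at least about half its length *)

Section Reversal.
Variables (T : eqType) (rrh rcap : ramp T -> nat).
Implicit Types r b : ramp T.

Local Notation fwd r := (forward pred0 r).

Lemma size_take_cpath r i : i <= edges r -> size (take i (cpath r)) = i.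
Proof.
case: r => v q ss f; rewrite /edges /= size_take /= => hi.
by case: ltnP => //; lia.
Qed.

Lemma edges_plain_backward r i : i <= edges r -> edges (plain_backward r i) = i.
Proof. by move=> hi; rewrite /edges /= size_rev size_take_cpath. Qed.

Lemma capacity_plain_backward r i : i <= edges r ->
  capacity rrh rcap (plain_backward r i) = \sum_(j < i.+1) j.
Proof.
move=> hi; rewrite /capacity /= size_rev size_take_cpath //.
apply: eq_bigr => j _; rewrite /level /sides_at /= addn0 big1 ?addn0 // => l _.
by rewrite big_nil.
Qed.

(** Side ramps only raise the central path and add blocks, so the bare staircase is a lower
    bound. *)
Lemma capacity_forward r i : i <= edges r ->
  \sum_(j < (edges r - i).+1) j <= capacity rrh rcap (fwd r i).
Proof.
move=> hi; rewrite /capacity.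
have -> : size (cpath (fwd r i)) = (edges r - i).+1.
  by case: r hi => v q ss f; rewrite /edges /= size_drop.
by apply: leq_sum => j _; rewrite /level -!addnA leq_addr.
Qed.

(** Turns comparisons of capacities, bounded by triangular numbers, into comparisons of lengths. *)
Lemma sum_ord_lt m n : \sum_(j < m) j < \sum_(j < n) j -> m < n.
Proof.
apply: contraTT; rewrite -!leqNgt => hnm; rewrite -(subnKC hnm).
by rewrite big_split_ord leq_addr.
Qed.

(* The forward ramp is extended only when its current length does not exceed
   that of the backward one, so the former never exceeds the latter by more
   than one; this is the second hypothesis. *)
Lemma pivot_ge_half r n i :
  i + n <= edges r -> edges r <= (i + n) + i.+1 ->
  let m := pivot rrh rcap (plain_backward r) (fwd r) n i in
  m <= edges r <= m.*2.+1.
Proof.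
elim: n i => [|n IHn] i hle hge /=; first by apply/andP; split; lia.
case: ifP => [_|/negbT]; first by apply: IHn; lia.
rewrite -ltnNge => hlt; apply: IHn; first by lia.
(* The backward extension was refused, so the forward ramp has length at most [i], which keeps the
   invariant when it grows by one. *)
have hB := @capacity_plain_backward r i.+1 ltac:(lia).
have hF := @capacity_forward r (i + n.+1) hle.
have := leq_ltn_trans hF hlt; rewrite hB => /sum_ord_lt; lia.
Qed.

(** The chosen backward ramp is at least as high as the one without side ramps, whose height is the
    pivot index. *)
Lemma rrh_ge_half r : max_reversal rrh rcap -> edges r <= (rrh r).*2.+1.
Proof.
move=> hmax; have [b [[b1 [b2 [_ -> hb]]] -> _]] := hmax r.
have /andP[h1 h2] := @pivot_ge_half r (edges r) 0 (leqnn _) ltac:(lia).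
have hp : edges r <= (height rrh (plain_backward r
    (pivot rrh rcap (plain_backward r) (fwd r) (edges r) 0))).*2.+1.
  by rewrite /height edges_plain_backward //= big_nil addn0.
by case: hb => [[-> hb]|[-> _]] //; lia.
Qed.

End Reversal.

(** * Uniqueness of simple paths in trees *)

Section UniquePaths.
Variable T : eqType.
Implicit Types (e t : rel T) (x y u v : T) (p q : seq T).

(** The form of acyclicity that later identifies the central path of a side ramp with a farthest
    path. *)
Definition unique_paths t : Prop := forall x p q,
  simple_path t x p -> simple_path t x q -> last x p = last x q -> p = q.

Lemma last_notin_cons x y q : uniq (x :: y :: q) -> last x (y :: q) != x.
Proof.
by case/andP=> hx _; apply: contraNneq hx => <- /=; exact: mem_last.
Qed.

(** [u] is isolated in [t] and hangs from [v] in [t']. A simple path cannot pass through [u], as it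
    would visit [v] just before and just after; so [u] occurs only at an end, and removing it leaves
    a simple path of [t]. Serves both a search step and the joining of the border root. *)
Lemma unique_paths_leaf t t' u v :
    (forall x, t u x = false) -> (forall x, t x u = false) -> u != v ->
    (forall x y, t' x y = [|| t x y, (x == v) && (y == u) | (x == u) && (y == v)]) ->
  unique_paths t -> unique_paths t'.
Proof.
move=> tux txu neq_uv t'E uniq_t.
have t'u x : t' u x = (x == v) by rewrite t'E tux (negbTE neq_uv) eqxx.
have t'xu x : t' x u = (x == v).
  by rewrite t'E txu eqxx (negbTE neq_uv) andbT andbF orbF.
have avoid x q : u \notin x :: q -> path t' x q = path t x q.
  elim: q x => //= y q IHq x; rewrite !inE !negb_or => /and3P[hx hy hq].
  rewrite IHq ?inE ?negb_or ?hy // t'E.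
  by rewrite ![_ == u]eq_sym (negbTE hx) (negbTE hy) andbF !orbF.
have inner x q : simple_path t' x q -> x != u -> last x q != u -> u \notin q.
  case/andP=> hp hu hxu hlu; apply/negP => hin.
  case/splitPr: hin hp hu hlu => q1 [|b q2]; first by rewrite last_cat eqxx.
  rewrite cat_path [path _ _ (_ :: _)]/= t'xu t'u => /and4P[_ /eqP hv /eqP-> _].
  rewrite -cat_cons cat_uniq => /and3P[_ /hasPn/(_ v)].
  by rewrite !inE eqxx orbT -hv -in_cons mem_last => /(_ isT).
have simple_t x q : simple_path t' x q -> u \notin x :: q -> simple_path t x q.
  by rewrite /simple_path => /[swap] /avoid->.
have at_end x q : simple_path t' x q -> x != u -> last x q = u ->
  exists q', [/\ q = rcons q' u, simple_path t x q' & last x q' = v].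
  case/lastP: q => [|q y] /=; first by move=> _ /eqP.
  rewrite last_rcons => + hxu hy; rewrite {}hy /simple_path rcons_path t'xu.
  rewrite -rcons_cons rcons_uniq => /andP[/andP[hp /eqP hl] /andP[hu huq]].
  by exists q; split=> //; apply: simple_t => //; rewrite /simple_path hp.
move=> x p q hp hq heq; case: (eqVneq x u) => [hx|hxu].
  rewrite {x}hx in hp hq heq.
  have from_u s : simple_path t' u s -> s = [::] \/
      exists2 s', s = v :: s' & simple_path t v s'.
    case: s => [|y s]; [by left | rewrite /simple_path /= t'u].
    case/andP=> /andP[/eqP-> hs] /andP[hu huq]; right; exists s => //.
    by apply: simple_t => //; rewrite /simple_path hs.
  have [hp0|[p' hp' sp]] := from_u p hp; have [hq0|[q' hq' sq]] := from_u q hq.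
  - by rewrite hp0 hq0.
  - move: heq hq; rewrite hp0 hq' => /= heq /andP[_ /last_notin_cons] /=.
    by rewrite -heq eqxx.
  - move: heq hp; rewrite hq0 hp' => /= heq /andP[_ /last_notin_cons] /=.
    by rewrite heq eqxx.
  - by rewrite hp' hq' (uniq_t v p' q') //; move: heq; rewrite hp' hq'.
case: (eqVneq (last x p) u) => [hl|hlu].
  have [p' [-> sp lp]] := at_end _ _ hp hxu hl.
  have [q' [-> sq lq]] := at_end _ _ hq hxu (etrans (esym heq) hl).
  by rewrite (uniq_t x p' q') // lp lq.
apply: (uniq_t x) => //; apply: simple_t => //.
  by rewrite inE negb_or eq_sym hxu (inner x p).
by rewrite inE negb_or eq_sym hxu (inner x q) // -heq.
Qed.

(** Cut the path at its last visit to [S], then shorten the rest to a simple path. *)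
Lemma path_last_exit e (S : {pred T}) x p : path e x p -> x \in S ->
  exists y q, [/\ y \in S, simple_path e y q, last y q = last x p &
                  forall z, z \in q -> z \notin S].
Proof.
have [n le_pn] := ubnP (size p); elim: n => // n IHn in x p le_pn *.
move=> hp Sx; case: (boolP (has [in S] p)) => [/hasP[y yp Sy]|/hasPn hS].
  case/splitPr: yp le_pn hp => p1 p2.
  rewrite cat_path last_cat size_cat /= => le_pn /and3P[_ _ hp2].
  by apply: IHn => //; lia.
case: (shortenP hp) => q hq uq sq.
by exists x, q; split=> //; [rewrite /simple_path hq | move=> z /sq/hS].
Qed.

Lemma tree_rel_sym (E : seq (T * T)) x y : tree_rel E x y = tree_rel E y x.
Proof. exact: orbC. Qed.

Lemma tree_rel_cons (E : seq (T * T)) u v x y :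
  tree_rel ((v, u) :: E) x y =
  [|| tree_rel E x y, (x == v) && (y == u) | (x == u) && (y == v)].
Proof.
rewrite /tree_rel !inE !xpair_eqE (andbC (y == v)).
by move: ((x, y) \in E) ((y, x) \in E) (_ && _) (_ && _) => [] [] [] [].
Qed.

End UniquePaths.

(** * Depth-first search trees *)

Section Dfs.
Variables (T : finType) (e : rel T) (a : {set T}).
Implicit Types (st : seq T) (D : {set T}) (E : seq (T * T)).
(* [fingraph] also defines a [dfs]. *)
Local Notation dfs := Defs.dfs.

Lemma dfs_stack_sub st D E : dfs e a st D E -> {subset st <= D}.
Proof.
elim=> {st D E} [r _ x|v u st D E _ IH _ _ x|v st D E _ IH _ x hx].
- by rewrite !inE.
- by rewrite in_setU1 inE => /predU1P[->|/IH->]; rewrite ?eqxx ?orbT.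
- by apply: IH; rewrite inE hx orbT.
Qed.

Lemma dfs_edge st D E x y : dfs e a st D E -> (x, y) \in E ->
  [/\ e x y, x \in D & y \in D].
Proof.
elim=> {st D E} // v u st D E hd IH evu _.
rewrite inE xpair_eqE => /orP[/andP[/eqP-> /eqP->]|/IH[exy hx hy]].
  by rewrite !in_setU1 eqxx (dfs_stack_sub hd) ?inE ?eqxx ?orbT.
by rewrite !in_setU1 hx hy !orbT.
Qed.

Lemma dfs_fresh st D E u x : dfs e a st D E -> u \notin D ->
  (tree_rel E u x = false) * (tree_rel E x u = false).
Proof.
move=> hd hu; rewrite [tree_rel E x u]tree_rel_sym.
suff -> : tree_rel E u x = false by [].
by apply/negP => /orP[] /(dfs_edge hd)[_ h1 h2]; case/negP: hu.
Qed.

(** Each push hangs [u], untouched by earlier edges, from [v] as a leaf. *)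
Lemma dfs_unique_paths st D E : dfs e a st D E -> unique_paths (tree_rel E).
Proof.
elim=> {st D E} [r _ x [|y p] [|z q]|v u st D E hd IH evu hu|] //.
have hv : v \in D by apply: (dfs_stack_sub hd); rewrite inE eqxx.
apply: (@unique_paths_leaf _ (tree_rel E) _ u v) => //.
- by move=> x; rewrite (dfs_fresh x hd hu).
- by move=> x; rewrite (dfs_fresh x hd hu).
- by apply: contraNneq hu => ->.
- exact: tree_rel_cons.
Qed.

Lemma dfs_connect st D E : dfs e a st D E ->
  {in D &, forall x y, connect (tree_rel E) x y}.
Proof.
elim=> {st D E} [r _ x y|v u st D E hd IH _ hu x y|] //.
  by rewrite !inE => /eqP-> /eqP->; exact: connect0.
have hv : v \in D by apply: (dfs_stack_sub hd); rewrite inE eqxx.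
set t := tree_rel _.
have sym_t : connect_sym t by apply: sym_connect_sym; exact: tree_rel_sym.
have tv z : z \in u |: D -> connect t v z.
  rewrite in_setU1 => /predU1P[->|hz].
    by apply: connect1; rewrite /t tree_rel_cons !eqxx orbT.
  apply: connect_sub (IH v z hv hz) => p q hpq.
  by apply: connect1; rewrite /t tree_rel_cons hpq.
by move=> hx hy; apply: connect_trans (tv y hy); rewrite sym_t tv.
Qed.

Lemma dfs_start_discovered st D E : dfs e a st D E ->
  exists2 r, r \in a & r \in D.
Proof.
elim=> {st D E} [r hr|v u st D E _ [r ra rD] _ _|//].
  by exists r; rewrite ?set11.
by exists r; rewrite // in_setU1 rD orbT.
Qed.

Lemma dfs_sub st D E : (forall x y, e x y -> y \in a) -> dfs e a st D E ->
  D \subset a.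
Proof.
move=> ea; elim=> {st D E} [r hr|v u st D E _ IH /ea hu _|//].
  by rewrite sub1set.
by rewrite subUset sub1set hu.
Qed.

(** A discovered node off the stack has been popped, which requires all its neighbors to be
    discovered. *)
Lemma dfs_closed st D E x y : dfs e a st D E -> x \in D -> x \notin st ->
  e x y -> y \in D.
Proof.
elim=> {st D E} [r _|v u st D E hd IH _ _|v st D E _ IH hv].
- by rewrite !inE => ->.
- rewrite !in_setU1 !inE !negb_or => /predU1P[->|hx]; first by rewrite eqxx.
  by case/and3P=> _ hxv hxs /IH->; rewrite ?orbT // inE negb_or hxv.
- move=> hx hxs hxy; case: (eqVneq x v) hxy => [->|hxv]; first exact: hv.
  by apply: IH; rewrite // inE negb_or hxv.
Qed.

End Dfs.

(** * Tree distances bounded by ramp height *)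

Section TreeDistance.
Variables (T : finType) (t : rel T).
Hypothesis sym_t : symmetric t.

Lemma path_reverse x p : path t x p ->
  exists2 p', path t (last x p) p' & last (last x p) p' = x /\ size p' = size p.
Proof.
move=> hp; exists (rev (belast x p)).
  rewrite rev_path; apply: sub_path hp => y z; by rewrite sym_t.
split; last by rewrite size_rev size_belast.
by case: p hp => //= y p _; rewrite rev_cons last_rcons.
Qed.

Variables (rrh rcap : ramp T -> nat) (root vk : T) (i : nat) (r : ramp T).
Hypotheses (hmax : max_reversal rrh rcap) (uniq_t : unique_paths t).
Hypothesis root_leaf : forall x y, t root x -> t root y -> x = y.

(* A shortest way from [vk] to [u] follows the central path up to some node
   [y] and then leaves it through a child [c]; the side ramp formed for [c] is
   at least as long as the second part, and is reversed to half its length. *)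
Lemma RFT_path_bound u : RFT t rrh i.+1 root vk r -> root != vk ->
    connect t vk u ->
  exists2 p, path t vk p & last vk p = u /\ size p <= (height rrh r).*2.+1.
Proof.
case=> q [ss [/andP[hq uq] lq -> [ch [sd [hch hsd ->]]]]] hroot /connectP[p0 hp0 ->].
(* Discarding side ramps of reversible height zero does not change the sum. *)
have heightE : height rrh (Ramp root q
    [seq s <- [seq sd vi vc | vi <- rev q, vc <- ch vi] | 0 < rrh s] 0) =
    size q + \sum_(vi <- q) \sum_(vc <- ch vi) rrh (sd vi vc).
  rewrite /height /= big_filter big_mkcond big_allpairs_dep (perm_big q) ?perm_rev //.
  congr addn; do 2!apply: eq_bigr => ? _; by case: (rrh _).
rewrite heightE {heightE}.
have vk_in : vk \in root :: q by rewrite -lq mem_last.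
have [y [p2 [Sy /andP[hp2 up2] <- Sp2]]] := path_last_exit hp0 vk_in.
have [p1 hp1 [lp1 sp1]] :
    exists2 p1, path t vk p1 & last vk p1 = y /\ size p1 <= size q.
  case/splitPl: Sy hq lq => q1 q2 hy; rewrite cat_path last_cat hy => /andP[_ hq2] lq.
  have [p1] := path_reverse hq2; rewrite lq => hp1 [hl hs].
  by exists p1 => //; rewrite hs size_cat leq_addl.
exists (p1 ++ p2); first by rewrite cat_path hp1 lp1.
rewrite last_cat lp1 size_cat; split=> //.
case: p2 hp2 up2 Sp2 => [|c p2] hp2 up2 Sp2; first by rewrite /= addn0; lia.
have c_off : c \notin root :: q by apply: Sp2; rewrite inE eqxx.
have tyc : t y c by case/andP: hp2.
(* The path cannot leave at the root: the root is a leaf whose only neighbor is on the central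
   path. *)
have yq : y \in q.
  move: Sy; rewrite /= inE => /predU1P[hy|//].
  case: q hq lq {uq hch hsd sp1 vk_in Sp2} c_off => [|b q].
    by move=> _ /= /eqP; rewrite (negbTE hroot).
  move=> /andP[hb _] _; rewrite (root_leaf _ hb : c = b) -?hy //.
  by rewrite !inE eqxx orbT.
have cch : c \in ch y.
  by rewrite (perm_mem (hch _ yq)) mem_filter tyc c_off mem_enum.
have [nd [qd [/andP[hqd uqd] y_qd lqd far]] hside] := hsd _ _ yq cch.
(* [p2] is simple and avoids [y], so it competes with the farthest path [qd]. *)
have hfar : size p2 <= size qd.
  have [/andP[_ hp2'] /andP[hy hu]] := conj hp2 up2.
  by apply: far => //; apply/andP; split.
(* By uniqueness of simple paths, the central path of this side ramp is [y] followed by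
   [c :: qd]. *)
have side_edges : edges (sd y c) = (size qd).+1.
  case: (i) hside => [|i'] /= [q' [ss' [sq' lq' -> _]]];
    by rewrite /edges /= (uniq_t (q := c :: qd) sq') //= /simple_path /= ?tyc ?hqd ?y_qd ?lq' //.
have := rrh_ge_half (sd y c) hmax; rewrite side_edges => hr.
have hsum : rrh (sd y c) <= \sum_(vi <- q) \sum_(vc <- ch vi) rrh (sd vi vc).
  by rewrite (big_rem y) //= (big_rem c) //= -addnA leq_addr.
move: hsum hr hfar sp1; rewrite /=.
by move: (rrh _) (\sum_(_ <- _) _) (size _) (size _) (size _) (size _); clear; lia.
Qed.

End TreeDistance.

(** * Counting grid positions *)

Section Grid.
Variables X Y : nat.
Implicit Types (p q : pos X Y) (a : {set pos X Y}).

Lemma nbr_sym : symmetric (@nbr X Y).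
Proof.
by move=> p q; rewrite /nbr (eq_sym p.2) (eq_sym p.1) [(_ == _) || _]orbC
  [(p.2.+1 == _) || _]orbC.
Qed.

(** Ball of the maximum norm, written without truncated subtraction. *)
Definition within m p q : bool :=
  [&& p.1 <= q.1 + m, q.1 <= p.1 + m, p.2 <= q.2 + m & q.2 <= p.2 + m].

Lemma path_within p s : path (@nbr X Y) p s -> within (size s) p (last p s).
Proof.
elim: s p => [|q s IH] p /=; first by rewrite /within !addn0 !leqnn.
case/andP=> hpq /IH; move: hpq; rewrite /within /nbr -!(inj_eq val_inj) /=; lia.
Qed.

(** Coordinates relative to [p], shifted by [m], embed the set in a square of side [2m+1]. *)
Lemma card_within m p a : {in a, forall q, within m p q} -> #|a| <= m.*2.+1 ^ 2.
Proof.
move=> ha; pose f q : 'I_(m.*2.+1) * 'I_(m.*2.+1) :=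
  (inord (q.1 + m - p.1), inord (q.2 + m - p.2)).
have := @leq_card_in _ _ f a; rewrite card_prod !card_ord -mulnn; apply.
move=> q q' /ha hq /ha hq' /(congr1 (fun c => (val c.1, val c.2))) [].
have bound b c : b <= c + m -> c <= b + m -> c + m - b < m.*2.+1 by lia.
have inj b c c' : b <= c + m -> b <= c' + m -> c + m - b = c' + m - b -> c = c' by lia.
move: hq hq'; rewrite /within => /and4P[h1 h2 h3 h4] /and4P[h1' h2' h3' h4'].
rewrite !inordK ?bound // => /(inj _ _ _ h1 h1') e1 /(inj _ _ _ h3 h3') e2.
by case: q q' {h1 h2 h3 h4 h1' h2' h3' h4'} e1 e2 => [q1 q2] [q1' q2'] /=
  /val_inj-> /val_inj->.
Qed.

(** * Ramp areas and their search trees *)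

Section Area.
Variables (z : pos X Y -> nat) (a : {set pos X Y}).
Hypothesis area : ramp_area z a.

Lemma ramp_area_not_border p : p \in a -> ~~ border p.
Proof.
case: area => [[x ex ->] _]; rewrite inE => /connectP[s hs ->].
suff /andP[] : empty_pos z (last x s) by [].
by elim: s x ex hs => //= y s IH x _ /andP[/and3P[_ _ ey]]; apply: IH.
Qed.

(** Once the stack is empty, [D] is closed under adjacency; it meets the connected component [a],
    hence contains it. *)
Lemma ramp_area_dfs_discovered E D :
  Defs.dfs [rel p q | [&& nbr p q, p \in a & q \in a]] a [::] D E -> a \subset D.
Proof.
move=> hd; have [r ra rD] := dfs_start_discovered hd.
have Da : D \subset a by apply: dfs_sub hd => x y /and3P[].
case: area => [[x ex aE] _].
set e0 := [rel p q | _] in aE.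
have sym_e0 : connect_sym e0.
  by apply: sym_connect_sym => p q; rewrite /= nbr_sym [empty_pos z p && _]andbC.
have clD : closed e0 D.
  apply: (intro_closed sym_e0) => p q hpq hp.
  have pa := subsetP Da _ hp.
  apply: (dfs_closed hd hp) => //=.
  rewrite pa; case/and3P: (hpq) => -> _ _ /=.
  by move: pa; rewrite aE !inE => /connect_trans; apply; apply: connect1.
apply/subsetP => y ya; move: ra ya; rewrite aE !inE sym_e0 => rx xy.
by rewrite -(closed_connect clD (connect_trans rx xy)).
Qed.

(** Tree paths are grid paths, so [a] lies in the ball of radius [2h+1] around [vk]. *)
Lemma reramp_card_bound i_r h : reramp_height i_r.+1 a h ->
  0 < h /\ #|a| <= (h.*2.+1).*2.+1 ^ 2.
Proof.
case=> rrh [rcap [v0 [w [vk [E [r [hmax [bv0 wa nv0w] [[D hd] vka] hr ->]]]]]]].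
have aD := subsetP (ramp_area_dfs_discovered hd).
have v0a : v0 \notin a by apply: contraL bv0 => /ramp_area_not_border.
have Da : D \subset a by apply: dfs_sub hd => x y /and3P[].
have v0D : v0 \notin D by apply: contra v0a; apply: (subsetP Da).
set t := tree_rel _ in hr.
have tE x y : t x y =
    [|| tree_rel E x y, (x == w) && (y == v0) | (x == v0) && (y == w)].
  by rewrite /t tree_rel_cons [(_ && _) || (_ && _)]orbC.
have neq_v0 x : x \in a -> (v0 == x) = false.
  by move=> xa; apply: contraNF v0a => /eqP->.
have fresh x : (tree_rel E v0 x = false) * (tree_rel E x v0 = false) :=
  dfs_fresh x hd v0D.
(* [v0] is on the border, hence outside [a], so it is a new leaf hanging from [w]. *)
have uniq_t : unique_paths t.
  apply: (@unique_paths_leaf _ (tree_rel E) _ v0 w) => // [x|x||].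
  - by rewrite fresh.
  - by rewrite fresh.
  - by rewrite neq_v0.
  - exact: dfs_unique_paths hd.
have sym_t : symmetric t by move=> x y; apply: tree_rel_sym.
have tv0 x : t v0 x -> x = w.
  by rewrite tE fresh neq_v0 //= eqxx => /eqP.
have t_nbr : subrel t (@nbr X Y).
  have E_nbr x y : (x, y) \in E -> nbr x y by case/(dfs_edge hd)=> /and3P[].
  move=> x y; rewrite tE => /or3P[/orP[/E_nbr|/E_nbr]|/andP[/eqP-> /eqP->]
    |/andP[/eqP-> /eqP->]] //; by rewrite nbr_sym.
have v0vk : v0 != vk by rewrite neq_v0.
split.
  case: hr => q [ss [_ lq -> _]]; case: q lq => [/= eq_v0|//].
  by rewrite eq_v0 eqxx in v0vk.
apply: (@card_within _ vk) => u ua.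
have hvu : connect t vk u.
  apply: connect_sub (dfs_connect hd (aD _ vka) (aD _ ua)) => x y hxy.
  by apply: connect1; rewrite tE hxy.
have leaf x y : t v0 x -> t v0 y -> x = y by move=> /tv0-> /tv0->.
have [p hp [<- hs]] := RFT_path_bound sym_t hmax uniq_t leaf hr v0vk hvu.
have := path_within (sub_path t_nbr hp); rewrite /within; lia.
Qed.

End Area.
End Grid.

(** * The square root lower bound *)

Local Open Scope ring_scope.

Theorem lemma7 (R : realType) (i_r : nat) :
  (1 <= i_r)%N ->
  exists (C : R) (n0 : nat), [/\ 0 < C, (0 < n0)%N &
    forall (X Y : nat) (z : pos X Y -> nat) (a : {set pos X Y}) (h : nat),
      world z -> ramp_area z a -> (n0 <= #|a|)%N ->
      worst_case_reramp_height i_r a h ->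
      C * Num.sqrt (#|a|%:R) <= h%:R].
Proof.
(* The constant comes from [4h+3 <= 7h], valid since [h >= 1]. *)
case: i_r => // i_r _; exists 7%:R^-1, 1%N; split=> // [|X Y z a h _ area _ [hh _]].
  by rewrite invr_gt0 ltr0n.
have [h_gt0 hcard] := reramp_card_bound area hh.
rewrite mulrC ler_pdivrMr ?ltr0n // -natrM.
rewrite -[leRHS]ger0_norm ?ler0n // -sqrtr_sqr -natrX.
apply: ler_wsqrtr; rewrite ler_nat (leq_trans hcard) // leq_exp2r //; lia.
Qed.
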